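(* Let $\mathfrak{T}$ and $\mathfrak{S}$ be $\mathcal{L}$-trees and let $a\in T$ and $b\in S$ be such that $(\mathfrak{T};a)\equiv^n(\mathfrak{S};b)$. Then: (i) $\mathfrak{T}^{>a}\equiv^n\mathfrak{S}^{>b}$; (ii) $\left(\mathfrak{T}^{\geqslant a};a\right)\equiv^n\left(\mathfrak{S}^{\geqslant b};b\right)$; (iii) $\left(\mathfrak{T}^{\not>a};a\right)\equiv^n\left(\mathfrak{S}^{\not>b};b\right)$; (iv) $\left(\mathfrak{T}^{\not>a};(-\infty,a]\right)\equiv^n\left(\mathfrak{S}^{\not>b};(-\infty,b]\right)$; (v) $\left(\mathfrak{T}^{\not\geqslant a};(-\infty,a)\right)\equiv^n\left(\mathfrak{S}^{\not\geqslant b};(-\infty,b)\right)$.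
   Context: A tree is a structure $\mathfrak{T}=(T;<)$ with $T$ non-empty and $<$ a strict partial order that is downwards linear (each set $\{x : x \leqslant t\}$ is totally ordered) and downwards connected (for all $s,t$ there is $x$ with $x\leqslant s$ and $x\leqslant t$). The language $\mathcal{L}$ consists of $=$, $<$ and finitely many constants and unary predicates; an $\mathcal{L}$-tree is a tree in this language. $(\mathfrak{T};a)$ and $(\mathfrak{T};A)$ denote expansions by a constant $a$, respectively a unary predicate $A$. $\equiv^n$ denotes agreement on all first-order sentences of quantifier rank at most $n$ ($n$ a natural number). For $a\in T$: $\mathfrak{T}^{>a}$, $\mathfrak{T}^{\geqslant a}$, $\mathfrak{T}^{\not>a}$, $\mathfrak{T}^{\not\geqslant a}$ are the restrictions of $\mathfrak{T}$ to $\{x : a<x\}$, $\{x : a\leqslant x\}$, $T\setminus\{x : a<x\}$, $T\setminus\{x : a\leqslant x\}$ respectively. $(-\infty,a]=\{x : x\leqslant a\}$ and $(-\infty,a)=\{x : x<a\}$. When a tree is restricted to a subset, constants of the language lying outside the subset are dropped; $n$-equivalence of two restrictions includes that the same constants are retained in both. Restrictions may be empty. *)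

(* Defs.v *)
From mathcomp Require Import all_boot.
From mathcomp Require Import boolp classical_sets.

Set Implicit Arguments.
Unset Strict Implicit.
Unset Printing Implicit Defensive.

Local Open Scope classical_set_scope.

(* The binary symbols = and < belong to every language and are left implicit. *)
Record language := Language { consts : finType; preds : finType }.

(* The new symbol of an expanded language is [None]. *)
Definition lang_const (L : language) : language :=
  Language (option (consts L)) (preds L).
Definition lang_pred (L : language) : language :=
  Language (consts L) (option (preds L)).

(* [cst c = None] means that the constant c has been dropped, so that the
   actual language of a structure M over L is L with its constants cut down to
   [retained M].  The carrier may be empty. *)
Record structure (L : language) := Structure {
  carrier :> Type;
  lt : carrier -> carrier -> Prop;
  cst : consts L -> option carrier;
  prd : preds L -> set carrier }.

Arguments lt {L s}.
Arguments cst {L} s.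
Arguments prd {L} s.

Definition retained L (M : structure L) : set (consts L) := [set c | cst M c].

Definition le L (M : structure L) (x y : M) : Prop := x = y \/ lt x y.

Record is_tree L (M : structure L) : Prop := IsTree {
  tree_nonempty : exists x : M, True;
  tree_irr : forall x : M, ~ lt x x;
  tree_trans : forall x y z : M, lt x y -> lt y z -> lt x z;
  tree_linear : forall t x y : M, le x t -> le y t -> le x y \/ le y x;
  tree_connected : forall s t : M, exists x : M, le x s /\ le x t }.

Record Ltree (L : language) := LTree {
  tree_structure :> structure L;
  tree_axioms : is_tree tree_structure;
  tree_consts : forall c : consts L, cst tree_structure c }.

Definition restrict L (M : structure L) (A : set M) : structure L :=
  @Structure L (set_type A)
    (fun x y => lt (val x) (val y))
    (fun c => obind insub (cst M c))
    (fun p => [set x | prd M p (val x)]).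

Definition with_const L (M : structure L) (a : M) : structure (lang_const L) :=
  @Structure (lang_const L) M lt
    (fun c => if c is Some c' then cst M c' else Some a)
    (prd M).

Definition with_pred L (M : structure L) (A : set M) : structure (lang_pred L) :=
  @Structure (lang_pred L) M lt (cst M)
    (fun p => if p is Some p' then prd M p' else A).

Section Cones.
Context {L : language} {M : structure L}.
Implicit Types a : M.

Definition above a : set M := [set x | lt a x].
Definition above_eq a : set M := [set x | le a x].
Definition not_above a : set M := ~` above a.
Definition not_above_eq a : set M := ~` above_eq a.
Definition below a : set M := [set x | lt x a].
Definition below_eq a : set M := [set x | le x a].

Lemma mem_above_eq a : a \in above_eq a.
Proof. by rewrite inE; left. Qed.

End Cones.

Lemma mem_not_above L (T : Ltree L) (a : T) : a \in not_above a.
Proof. by rewrite inE; apply: (tree_irr (tree_axioms T)). Qed.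

(* Formulas whose free variables are indexed by 'I_k; a quantifier binds
   index 0 of its body.  Scoping is intrinsic so that sentences can be
   evaluated in an empty structure. *)
Inductive term (L : language) (k : nat) :=
  | Var of 'I_k
  | Cst of consts L.

Inductive formula (L : language) : nat -> Type :=
  | FFalse k : formula L k
  | FEq k : term L k -> term L k -> formula L k
  | FLt k : term L k -> term L k -> formula L k
  | FPred k : preds L -> term L k -> formula L k
  | FNot k : formula L k -> formula L k
  | FAnd k : formula L k -> formula L k -> formula L k
  | FOr k : formula L k -> formula L k -> formula L k
  | FImp k : formula L k -> formula L k -> formula L k
  | FAll k : formula L k.+1 -> formula L k
  | FEx k : formula L k.+1 -> formula L k.

Definition sentence (L : language) := formula L 0.

Fixpoint qrank L k (f : formula L k) : nat :=
  match f with
  | FFalse _ | FEq _ _ _ | FLt _ _ _ | FPred _ _ _ => 0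
  | FNot _ g => qrank g
  | FAnd _ g h | FOr _ g h | FImp _ g h => maxn (qrank g) (qrank h)
  | FAll _ g | FEx _ g => (qrank g).+1
  end.

Definition term_over L (C : set (consts L)) k (t : term L k) : Prop :=
  if t is Cst c then C c else True.

(* All constants occurring in the formula belong to C. *)
Fixpoint formula_over L (C : set (consts L)) k (f : formula L k) : Prop :=
  match f with
  | FFalse _ => True
  | FEq _ t u | FLt _ t u => term_over C t /\ term_over C u
  | FPred _ _ t => term_over C t
  | FNot _ g => formula_over C g
  | FAnd _ g h | FOr _ g h | FImp _ g h => formula_over C g /\ formula_over C h
  | FAll _ g | FEx _ g => formula_over C g
  end.

Definition env_cons (T : Type) k (x : T) (e : 'I_k -> T) : 'I_k.+1 -> T :=
  fun i => if unlift ord0 i is Some j then e j else x.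

Definition env_nil (T : Type) : 'I_0 -> T :=
  fun i => False_rect T (notF (ltn_ord i)).

Definition eval L (M : structure L) k (e : 'I_k -> M) (t : term L k) : option M :=
  match t with Var i => Some (e i) | Cst c => cst M c end.

(* Atoms containing a dropped constant get the junk value False; such formulas
   are not in the language of M and are excluded in [nequiv]. *)
Fixpoint sat L (M : structure L) k (f : formula L k) : ('I_k -> M) -> Prop :=
  match f in formula _ k return ('I_k -> M) -> Prop with
  | FFalse _ => fun _ => False
  | FEq _ t u => fun e =>
      if (eval e t, eval e u) is (Some x, Some y) then x = y else False
  | FLt _ t u => fun e =>
      if (eval e t, eval e u) is (Some x, Some y) then lt x y else False
  | FPred _ p t => fun e => if eval e t is Some x then prd M p x else False
  | FNot _ g => fun e => ~ sat g e
  | FAnd _ g h => fun e => sat g e /\ sat h e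
  | FOr _ g h => fun e => sat g e \/ sat h e
  | FImp _ g h => fun e => sat g e -> sat h e
  | FAll _ g => fun e => forall x : M, sat g (env_cons x e)
  | FEx _ g => fun e => exists x : M, sat g (env_cons x e)
  end.

Definition models L (M : structure L) (f : sentence L) : Prop :=
  sat f (@env_nil M).

Definition nequiv L (n : nat) (M N : structure L) : Prop :=
  retained M = retained N /\
  forall f : sentence L, formula_over (retained M) f -> qrank f <= n ->
    (models M f <-> models N f).

(* Main.v *)
(* Each of the restricted structures is interpreted in (T; a) without raising
   quantifier rank: its domain and its new predicate are definable from a by
   quantifier-free formulas, so relativizing the quantifiers of a sentence
   turns truth in the restriction into truth in (T; a).  The constants that
   survive are also read off from quantifier-free sentences of (T; a). *)

Require Import Defs.
From mathcomp Require Import all_boot.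
From mathcomp Require Import boolp classical_sets.

Set Implicit Arguments.
Unset Strict Implicit.
Unset Printing Implicit Defensive.

Local Open Scope classical_set_scope.

Lemma formula_over_setT L k (f : formula L k) : formula_over setT f.
Proof.
by elim: f => {k} //= k; [case=> ? [] ?|case=> ? [] ?|move=> ? []].
Qed.

(* A formula with one distinguished variable, given by its substitution
   instances, so that no substitution operation on formulas is needed. *)
Definition scheme (L : language) := forall k, term L k -> formula L k.

Definition quantifier_free L (D : scheme L) :=
  forall k (t : term L k), qrank (D k t) = 0.

(** Only terms with a value are tested: on a dropped constant an atom has a junk truth value, which
    says nothing about [A]. *)
Definition defines L (M : structure L) (D : scheme L) (A : set M) :=
  forall k (e : 'I_k -> M) t x, eval e t = Some x -> (sat (D k t) e <-> A x).

(** Constants go to constants, so terms translate to terms and atoms need no auxiliary quantifiers;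
    together with the rank 0 schemes this keeps the quantifier rank fixed. *)
Record interpretation (K L : language) := Interpretation {
  dom_scheme : scheme K;
  cst_symbol : consts L -> consts K;
  prd_scheme : preds L -> scheme K;
  dom_quantifier_free : quantifier_free dom_scheme;
  prd_quantifier_free : forall p, quantifier_free (prd_scheme p) }.

Arguments dom_scheme {K L}.
Arguments cst_symbol {K L}.
Arguments prd_scheme {K L}.

(** * Relativization along a quantifier-free interpretation *)

Section Relativization.
Context {K L : language} (I : interpretation K L).
Implicit Types (M : structure K) (N : structure L).

Definition relativize_term k (t : term L k) : term K k :=
  match t with Var i => Var K i | Cst c => Cst k (cst_symbol I c) end.

Fixpoint relativize k (f : formula L k) : formula K k :=
  match f with
  | FFalse k => FFalse K k
  | FEq _ t u => FEq (relativize_term t) (relativize_term u)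
  | FLt _ t u => FLt (relativize_term t) (relativize_term u)
  | FPred _ p t => prd_scheme I p _ (relativize_term t)
  | FNot _ g => FNot (relativize g)
  | FAnd _ g h => FAnd (relativize g) (relativize h)
  | FOr _ g h => FOr (relativize g) (relativize h)
  | FImp _ g h => FImp (relativize g) (relativize h)
  | FAll _ g => FAll (FImp (dom_scheme I _ (Var K ord0)) (relativize g))
  | FEx _ g => FEx (FAnd (dom_scheme I _ (Var K ord0)) (relativize g))
  end.

Lemma qrank_relativize k (f : formula L k) : qrank (relativize f) = qrank f.
Proof.
elim: f => {k} //= => [k p t|k g -> h ->|k g -> h ->|k g -> h ->|k g ->|k g ->] //.
- exact: prd_quantifier_free.
- by rewrite dom_quantifier_free max0n.
- by rewrite dom_quantifier_free max0n.
Qed.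

(** [h] embeds [N] onto a definable part of [M]. By [interprets_cst], a constant is dropped in [N]
    exactly when its symbol has no value in that part. *)
Record interprets M N (h : N -> M) : Prop := {
  interprets_dom : defines (dom_scheme I) (range h);
  interprets_inj : injective h;
  interprets_lt : forall x y, lt x y <-> lt (h x) (h y);
  interprets_cst : forall c y,
    cst N c = Some y <-> cst M (cst_symbol I c) = Some (h y);
  interprets_prd : forall p,
    exists2 A, defines (M := M) (prd_scheme I p) A & prd N p = h @^-1` A }.

Arguments interprets M N h : clear implicits.

Lemma comp_env_cons (T U : Type) (h : T -> U) k x (e : 'I_k -> T) :
  h \o env_cons x e = env_cons (h x) (h \o e).
Proof. by apply/funext => i; rewrite /env_cons /=; case: unlift. Qed.

(** Retention of the constant in [t] rules out the junk case on both sides, so atoms can be compared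
    by their values. *)
Lemma eval_relativize M N (h : N -> M) k (e : 'I_k -> N) (t : term L k) :
  interprets M N h -> term_over (retained N) t ->
  exists2 x, eval e t = Some x & eval (h \o e) (relativize_term t) = Some (h x).
Proof.
move=> IMN; case: t => [i _|c] /=; first by exists (e i).
rewrite /retained /=; case E: (cst N c) => [y|] // _.
by exists y => //; apply/(interprets_cst IMN).
Qed.

Lemma sat_dom_var0 M N (h : N -> M) k (e : 'I_k -> M) x : interprets M N h ->
  sat (dom_scheme I _ (Var K ord0)) (env_cons x e) <-> range h x.
Proof.
move=> IMN; apply: (interprets_dom IMN).
by rewrite /= /env_cons unlift_none.
Qed.

(** Induction on [f]. Atoms transfer because [h] is an embedding; at a quantifier the guard confines
    the bound variable to [range h], and [comp_env_cons] turns a guarded value [h x] into the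
    extension of [e] by [x]. *)
Lemma sat_relativize M N (h : N -> M) k (f : formula L k) (e : 'I_k -> N) :
  interprets M N h -> formula_over (retained N) f ->
  sat (relativize f) (h \o e) <-> sat f e.
Proof.
move=> IMN; elim: f e => {k} /=.
- by [].
- move=> k t u e [/(eval_relativize e IMN)[x -> ->]].
  move=> /(eval_relativize e IMN)[y -> ->].
  by split=> [/(interprets_inj IMN)|->].
- move=> k t u e [/(eval_relativize e IMN)[x -> ->]].
  move=> /(eval_relativize e IMN)[y -> ->].
  by split=> /(interprets_lt IMN).
- move=> k p t e /(eval_relativize e IMN)[x -> tx].
  have [A defA ->] := interprets_prd IMN p.
  exact: defA tx.
- by move=> k g IHg e /(IHg e)->.
- by move=> k g IHg g' IHg' e [/(IHg e)-> /(IHg' e)->].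
- by move=> k g IHg g' IHg' e [/(IHg e)-> /(IHg' e)->].
- by move=> k g IHg g' IHg' e [/(IHg e)-> /(IHg' e)->].
- move=> k g IHg e og; split=> [gP x|gP y].
    apply/(IHg _ og); rewrite comp_env_cons; apply: gP.
    by apply/(sat_dom_var0 (h \o e) _ IMN); exists x.
  move=> /(sat_dom_var0 (h \o e) y IMN)[x _ <-].
  by rewrite -comp_env_cons; apply/IHg.
- move=> k g IHg e og; split=> [[y []]|[x gx]].
    move=> /(sat_dom_var0 (h \o e) y IMN)[x _ <-].
    by rewrite -comp_env_cons => /(IHg _ og) gx; exists x.
  exists (h x); split; last by rewrite -comp_env_cons; apply/IHg.
  by apply/(sat_dom_var0 (h \o e) _ IMN); exists x.
Qed.

Lemma models_relativize M N (h : N -> M) (f : sentence L) :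
  interprets M N h -> formula_over (retained N) f ->
  models M (relativize f) <-> models N f.
Proof.
move=> IMN of_; rewrite /models -(sat_relativize _ IMN of_).
by rewrite (_ : h \o _ = @env_nil M) //; apply/funext => -[].
Qed.

(** Since [M] drops nothing, the symbol of [c] has a value there, and [c] survives in [N] iff this
    value lies in the domain. *)
Lemma retained_interprets M N (h : N -> M) c :
  interprets M N h -> retained M = setT ->
  retained N c <-> models M (dom_scheme I _ (Cst 0 (cst_symbol I c))).
Proof.
move=> IMN MT.
have : retained M (cst_symbol I c) by rewrite MT.
rewrite /retained /=; case E: (cst M _) => [x|] // _.
rewrite /models; have -> := interprets_dom IMN (e := @env_nil M)
  (t := Cst 0 (cst_symbol I c)) E.
split=> [|[y _ hy]].
  case F: (cst N c) => [y|] // _; exists y => //.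
  by move/(interprets_cst IMN): F; rewrite E => -[].
by rewrite (proj2 (interprets_cst IMN c y)) // E hy.
Qed.

Lemma nequiv_interprets n M N (h : N -> M) M' N' (h' : N' -> M') :
  interprets M N h -> interprets M' N' h' -> retained M = setT ->
  nequiv n M M' -> nequiv n N N'.
Proof.
move=> IMN IMN' MT [MM' eqM].
(* With every constant retained, the restriction to formulas over [retained M] is vacuous. *)
have {}eqM g : qrank g <= n -> models M g <-> models M' g.
  by apply: eqM; rewrite MT; apply: formula_over_setT.
(* Retention of a constant is the truth of a rank 0 sentence, so it transfers for every [n],
   including 0. *)
have NN' : retained N = retained N'.
  apply/seteqP; split=> c.
    move=> /(retained_interprets c IMN MT).
    rewrite eqM ?dom_quantifier_free //.
    by move/(retained_interprets c IMN'); apply; rewrite -MM'.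
  move=> /(retained_interprets c IMN'); rewrite -MM' => /(_ MT).
  rewrite -eqM ?dom_quantifier_free //.
  by move/(retained_interprets c IMN); apply.
split=> // f of_ rf.
rewrite -(models_relativize IMN of_) eqM ?qrank_relativize //.
by apply: models_relativize IMN' _; rewrite -NN'.
Qed.

End Relativization.

Arguments interprets {K L} I M N h.

(** * Restrictions to definable sets as interpretations in the expansion by a constant *)

Section Restrictions.
Context {L : language} (D E : scheme (lang_const L)).
Context (qfD : quantifier_free D) (qfE : quantifier_free E).

Definition pred_scheme (K : language) (p : preds K) : scheme K :=
  fun k t => FPred p t.

Definition restrict_interpretation : interpretation (lang_const L) L :=
  @Interpretation (lang_const L) L D Some (@pred_scheme (lang_const L)) qfD
    (fun p k t => erefl).

Definition restrict_const_interpretation :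
    interpretation (lang_const L) (lang_const L) :=
  @Interpretation (lang_const L) (lang_const L) D id (@pred_scheme (lang_const L))
    qfD (fun p k t => erefl).

(** [Some] embeds the constants of [L] past the new symbol for [a], while [E] expresses the new
    predicate. The schemes must stay transparent to be computed later. *)
Definition restrict_pred_interpretation :
    interpretation (lang_const L) (lang_pred L).
Proof.
by refine (@Interpretation (lang_const L) (lang_pred L) D Some
  (fun p => if p is Some q then @pred_scheme (lang_const L) q else E) qfD _); case.
Defined.

Context {M : structure L} {a : M} {A B : set M}.
Context (defA : defines (M := with_const a) D A).
Context (defB : defines (M := with_const a) E B).

Lemma defines_range_val :
  defines (M := with_const a) D (range (val : restrict A -> M)).
Proof.
move=> k e t x /defA ->; split=> [Ax|[y _ <-]]; last exact/set_mem/valP.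
by exists (Sub x (mem_set Ax)).
Qed.

(** [insub] yields [None] outside [A], which is how constants get dropped; inside [A] it inverts
    [val]. *)
Lemma cst_restrict c (y : restrict A) :
  cst (restrict A) c = Some y <-> cst M c = Some (val y).
Proof.
rewrite /=; case: (cst M c) => [x|] //=; split=> [|[->]]; last by rewrite valK.
by case: insubP => // u _ <- [->].
Qed.

Lemma interprets_restrict :
  interprets restrict_interpretation (with_const a) (restrict A) val.
Proof.
split=> //; [exact: defines_range_val|exact: val_inj|exact: cst_restrict|].
by move=> p; exists (prd M p) => // k e t x /= ->.
Qed.

Lemma interprets_restrict_const (aA : a \in A) :
  interprets restrict_const_interpretation (with_const a)
    (with_const (M := restrict A) (Sub a aA)) val.
Proof.
split=> //; [exact: defines_range_val|exact: val_inj| |].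
  case=> [c|] y; first exact: cst_restrict.
  by split=> [[<-]|[ay]] //=; congr Some; apply: val_inj.
by move=> p; exists (prd M p) => // k e t x /= ->.
Qed.

Lemma interprets_restrict_pred :
  interprets restrict_pred_interpretation (with_const a)
    (with_pred (M := restrict A) (val @^-1` B)) val.
Proof.
split=> //; [exact: defines_range_val|exact: val_inj|exact: cst_restrict|].
by case=> [p|]; [exists (prd M p) => // k e t x /= ->|exists B].
Qed.

End Restrictions.

(** * Quantifier-free definitions of the cones and their complements *)

Section Cones.
Context {L : language}.

Definition above_scheme : scheme (lang_const L) :=
  fun k t => FLt (Cst (L := lang_const L) k None) t.
(** The equation is oriented as in [le a x], so that satisfaction unfolds to membership in
    [above_eq a]. *)
Definition above_eq_scheme : scheme (lang_const L) :=
  fun k t => FOr (FEq (Cst (L := lang_const L) k None) t) (above_scheme t).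
Definition below_scheme : scheme (lang_const L) :=
  fun k t => FLt t (Cst (L := lang_const L) k None).
Definition below_eq_scheme : scheme (lang_const L) :=
  fun k t => FOr (FEq t (Cst (L := lang_const L) k None)) (below_scheme t).
Definition not_scheme (D : scheme (lang_const L)) : scheme (lang_const L) :=
  fun k t => FNot (D k t).

Context {M : structure L} (a : M).

Lemma defines_above : defines (M := with_const a) above_scheme (above a).
Proof. by move=> k e t x /= ->. Qed.

Lemma defines_above_eq :
  defines (M := with_const a) above_eq_scheme (above_eq a).
Proof. by move=> k e t x /= ->. Qed.

Lemma defines_below : defines (M := with_const a) below_scheme (below a).
Proof. by move=> k e t x /= ->. Qed.

Lemma defines_below_eq :
  defines (M := with_const a) below_eq_scheme (below_eq a).
Proof. by move=> k e t x /= ->. Qed.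

Lemma defines_not_above :
  defines (M := with_const a) (not_scheme above_scheme) (not_above a).
Proof. by move=> k e t x /= ->. Qed.

Lemma defines_not_above_eq :
  defines (M := with_const a) (not_scheme above_eq_scheme) (not_above_eq a).
Proof. by move=> k e t x /= ->. Qed.

End Cones.

Arguments defines_above {L M} a.
Arguments defines_above_eq {L M} a.
Arguments defines_below {L M} a.
Arguments defines_below_eq {L M} a.
Arguments defines_not_above {L M} a.
Arguments defines_not_above_eq {L M} a.

Lemma retained_with_const L (T : Ltree L) (a : T) :
  retained (with_const a) = setT.
Proof.
by apply/seteqP; split=> // -[c|] _ //; apply: (tree_consts T).
Qed.

Theorem lemma3p2 (L : language) (T S : Ltree L) (a : T) (b : S) (n : nat)
    (hab : nequiv n (with_const a) (with_const b)) :
  [/\ nequiv n (restrict (above a)) (restrict (above b)),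
      nequiv n
        (with_const (M := restrict (above_eq a)) (Sub a (mem_above_eq a)))
        (with_const (M := restrict (above_eq b)) (Sub b (mem_above_eq b))),
      nequiv n
        (with_const (M := restrict (not_above a)) (Sub a (mem_not_above a)))
        (with_const (M := restrict (not_above b)) (Sub b (mem_not_above b))),
      nequiv n
        (with_pred (M := restrict (not_above a)) (val @^-1` below_eq a))
        (with_pred (M := restrict (not_above b)) (val @^-1` below_eq b))
    & nequiv n
        (with_pred (M := restrict (not_above_eq a)) (val @^-1` below a))
        (with_pred (M := restrict (not_above_eq b)) (val @^-1` below b))].
Proof.
have aT := retained_with_const a.
have qf1 : quantifier_free (@above_scheme L) by [].
have qf2 : quantifier_free (@above_eq_scheme L) by [].
have qf3 : quantifier_free (not_scheme (@above_scheme L)) by [].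
have qf4 : quantifier_free (not_scheme (@above_eq_scheme L)) by [].
have qf5 : quantifier_free (@below_scheme L) by [].
have qf6 : quantifier_free (@below_eq_scheme L) by [].
split.
(* In each of the five cases the same schemes serve both trees, with the new constant read as [a] in
   one and as [b] in the other. *)
- apply: nequiv_interprets aT hab;
    exact: (interprets_restrict qf1 (defines_above _)).
- apply: nequiv_interprets aT hab;
    exact: (interprets_restrict_const qf2 (defines_above_eq _) _).
- apply: nequiv_interprets aT hab;
    exact: (interprets_restrict_const qf3 (defines_not_above _) _).
- apply: nequiv_interprets aT hab;
    exact: (interprets_restrict_pred qf3 qf6
      (defines_not_above _) (defines_below_eq _)).
- apply: nequiv_interprets aT hab;
    exact: (interprets_restrict_pred qf4 qf5
      (defines_not_above_eq _) (defines_below _)).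
Qed.
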